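(* Let $M_2\in\mathrm{GL}_2(K)$ be such that the lines $L_0,L_\infty,L_1,L_2$ in $\mathbb P^3_K$ corresponding to $M_0,M_\infty,M_1=I,M_2$ are pairwise skew and $G_{\{L_0,L_\infty,L_1,L_2\}}\cong C_3$, the cyclic group of order $3$. Let $\mathcal L$ be a finite set of pairwise skew lines containing $\{L_0,L_\infty,L_1,L_2\}$ with $G_{\mathcal L}\cong C_3$. (a) If $\operatorname{char}(K)\ne2$, then $\mathcal L=\{L_0,L_\infty,L_1,L_2\}$; so $\mathcal L$ contains at most four lines. (b) If $\operatorname{char}(K)=2$, then the only possible additional line in $\mathcal L$ is the one corresponding to the matrix $M_3=I-M_2$, so $\mathcal L$ contains at most five lines; and the five lines corresponding to $M_0,M_\infty,I,M_2,I-M_2$ do form a set of pairwise skew lines whose group is isomorphic to $C_3$.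
   Context: $K$ is an algebraically closed field and $\mathbb P^3=\mathbb P(K^2\oplus K^2)$. $L_0=\{(v,0)\}$ (the line of $M_0=0$), $L_\infty=\{(0,v)\}$ (the line of the symbol $M_\infty$), and the line corresponding to a matrix $M\in\mathrm{GL}_2(K)$ is $\{(v,Mv)\mid v\in K^2\}$; every line skew to both $L_0$ and $L_\infty$ corresponds to a unique such $M$. For three distinct pairwise skew (i.e. disjoint) lines $L_i,L_j,L_k$, the map $f_{ijk}:L_i\to L_j$ sends $p\in L_i$ to the unique intersection point of $L_j$ with the plane spanned by $p$ and $L_k$. For a finite set $\mathcal L$ of at least three pairwise skew lines, $C_{\mathcal L}$ is the groupoid whose objects are the lines of $\mathcal L$ and whose arrows are the maps $f_{ijk}$ (with $L_i,L_j,L_k\in\mathcal L$ distinct) together with all their possible compositions; the groups $\mathrm{Hom}_{C_{\mathcal L}}(L_i,L_i)\subseteq\mathrm{Aut}(L_i)\cong\mathrm{PGL}_2(K)$ are all isomorphic, and $G_{\mathcal L}$ denotes this common group. *)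

(* Defs.v *)
From HB Require Import structures.
From mathcomp Require Import all_boot all_order all_fingroup all_algebra.
From mathcomp Require Import finmap.

Set Implicit Arguments.
Unset Strict Implicit.
Unset Printing Implicit Defensive.

Import GRing.Theory.
Local Open Scope ring_scope.
Local Open Scope fset_scope.

(* P^3 = P(K^2 + K^2): its points and lines are the subspaces of dimension 1  *)
(* and 2 of [ambient K].                                                      *)
Notation ambient K := ('cV[K]_2 * 'cV[K]_2)%type.

Definition is_line (K : fieldType) (L : {vspace ambient K}) : bool :=
  \dim L == 2%N.

Definition skew_lines (K : fieldType) (L L' : {vspace ambient K}) : bool :=
  (L :&: L' == 0)%VS.

(* Distinct positions are required to be skew, so the lines of s are          *)
(* pairwise distinct; a finite set of lines is coerced to its (duplicate      *)
(* free) enumeration.                                                         *)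
Definition pairwise_skew (K : fieldType) (s : seq {vspace ambient K}) : bool :=
  all (@is_line K) s && pairwise (@skew_lines K) s.

Definition graph_map (K : fieldType) (M : 'M[K]_2) (v : 'cV[K]_2) : ambient K :=
  (v, M *m v).

Definition infty_map (K : fieldType) (v : 'cV[K]_2) : ambient K := (0, v).

Fact graph_map_is_linear (K : fieldType) (M : 'M[K]_2) : linear (graph_map M).
Proof. by move=> a u v; rewrite /graph_map mulmxDr -scalemxAr. Qed.

HB.instance Definition _ (K : fieldType) (M : 'M[K]_2) :=
  GRing.isLinear.Build K 'cV[K]_2 (ambient K) _ (graph_map M)
    (graph_map_is_linear M).

Fact infty_map_is_linear (K : fieldType) : linear (@infty_map K).
Proof.
move=> a u v; rewrite /infty_map.
by congr pair; rewrite /= scaler0 addr0.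
Qed.

HB.instance Definition _ (K : fieldType) :=
  GRing.isLinear.Build K 'cV[K]_2 (ambient K) _ (@infty_map K)
    (@infty_map_is_linear K).

(* The line {(v, Mv)}; the line L_0 is [mxline 0]. *)
Definition mxline (K : fieldType) (M : 'M[K]_2) : {vspace ambient K} :=
  limg (linfun (graph_map M)).

Definition line_infty (K : fieldType) : {vspace ambient K} :=
  limg (linfun (@infty_map K)).

Lemma mem_mxline (K : fieldType) (M : 'M[K]_2) (u : ambient K) :
  (u \in mxline M) = (u.2 == M *m u.1).
Proof.
apply/memv_imgP/eqP=> [[v _ ->]|uE]; first by rewrite lfunE.
by exists u.1; rewrite ?memvf // lfunE /= /graph_map -uE; case: (u).
Qed.

Lemma mem_line_infty (K : fieldType) (u : ambient K) :
  (u \in line_infty K) = (u.1 == 0).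
Proof.
apply/memv_imgP/eqP=> [[v _ ->]|uE]; first by rewrite lfunE.
by exists u.2; rewrite ?memvf // lfunE /= /infty_map -uE; case: (u).
Qed.

Definition point (K : fieldType) (L : {vspace ambient K}) :=
  {p : {vspace ambient K} | (p <= L)%VS && (\dim p == 1%N)}.

(* The arrows Li -> Lj of the groupoid C_S. The map f_ijk is given by its     *)
(* graph: f p is the intersection of Lj with the plane spanned by p and Lk.   *)
(* The inverse of f_ijk is f_jik, so identities and inverses are compositions.*)
Inductive arrow (K : fieldType) (S : {fset {vspace ambient K}}) :
    forall Li Lj : {vspace ambient K}, (point Li -> point Lj) -> Prop :=
| arrow_gen (Li Lj Lk : {vspace ambient K}) (f : point Li -> point Lj) :
    Li \in S -> Lj \in S -> Lk \in S -> uniq [:: Li; Lj; Lk] ->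
    (forall p, val (f p) = (Lj :&: (val p + Lk))%VS) ->
    arrow S f
| arrow_comp (Li Lj Lk : {vspace ambient K})
    (f : point Li -> point Lj) (g : point Lj -> point Lk) :
    arrow S f -> arrow S g -> arrow S (g \o f).

(* The group G_S is isomorphic to gT. As G_S is only defined up to            *)
(* isomorphism, this is required of every vertex group Hom(L, L), L in S.     *)
Definition G_isog (K : fieldType) (S : {fset {vspace ambient K}})
    (gT : finGroupType) : Prop :=
  forall L, L \in S ->
  exists phi : gT -> (point L -> point L),
    [/\ forall x y, phi (x * y)%g = phi x \o phi y,
        injective phi
      & forall f, arrow S f <-> exists x, phi x = f].

Definition four_lines (K : fieldType) (M2 : 'M[K]_2) :
    seq {vspace ambient K} :=
  [:: mxline 0; line_infty K; mxline 1%:M; mxline M2].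

Definition five_lines (K : fieldType) (M2 : 'M[K]_2) :
    seq {vspace ambient K} :=
  rcons (four_lines M2) (mxline (1%:M - M2)).

(* Main.v *)
(** In the coordinates v of the lines {(v, Xv)} and {(0, v)}, the map f_ijk is
    given by (X_j - X_k)^-1 (X_i - X_k), by X_i - X_k, by (X_j - X_k)^-1 or by
    the identity, so that the group at L_0 is generated in PGL_2 by the
    differences X - Y.  If it is C_3, then M_2 is not scalar, M_2 and M_2 - I
    have order 3 in it, and comparing coefficients forces M_2^2 = M_2 - I.  For
    a further line, the differences N, N - I and N - M_2 are all multiples of I,
    M_2 or M_2 - I; in the basis (I, M_2) this leaves N = I - M_2 with 2 = 0.
    Conversely, in characteristic 2 all the differences for the five lines are
    multiples of powers of M_2, so adding the fifth line creates no new arrow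
    from L_0 to itself. *)

Require Import Defs.
From mathcomp Require Import all_boot all_order all_fingroup all_algebra.
From mathcomp Require Import finmap.
From Stdlib Require Import FunctionalExtensionality.

Import GRing.Theory.
Local Open Scope ring_scope.

Section Lines.
Context {K : fieldType}.
Implicit Types (L : {vspace ambient K}) (X Y M A B : 'M[K]_2) (u w : ambient K).

(** * Lines as graphs of matrices, and skewness *)

Lemma mulmx_colP A B : (forall v : 'cV_2, A *m v = B *m v) -> A = B.
Proof.
move=> eqAB; apply/matrixP=> i j.
by have /colP/(_ i) := eqAB (delta_mx j 0); rewrite -!colE !mxE.
Qed.

Lemma mxline_inj : injective (@mxline K).
Proof.
move=> X Y eqXY; apply: mulmx_colP => v.
have : ((v, X *m v) : ambient K) \in mxline X by rewrite mem_mxline.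
by rewrite eqXY mem_mxline => /eqP.
Qed.

Lemma mxline_neq_infty X : mxline X != line_infty K.
Proof.
apply/eqP=> eqX.
have : ((const_mx 1, X *m const_mx 1) : ambient K) \in mxline X.
  by rewrite mem_mxline.
rewrite eqX mem_line_infty => /eqP/matrixP/(_ 0 0)/eqP.
by rewrite !mxE oner_eq0.
Qed.

Lemma skew_linesP L L' :
  reflect (forall u, u \in L -> u \in L' -> u = 0) (skew_lines L L').
Proof.
rewrite /skew_lines -subv0; apply: (iffP subvP) => [sk u uL uL'|sk u].
  by apply/eqP; rewrite -memv0; apply: sk; rewrite memv_cap uL.
by rewrite memv_cap memv0 => /andP[uL uL']; rewrite (sk u).
Qed.

Lemma skew_linesC L L' : skew_lines L L' = skew_lines L' L.
Proof. by rewrite /skew_lines capvC. Qed.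

Lemma skew_mxline_infty X : skew_lines (mxline X) (line_infty K).
Proof.
apply/skew_linesP=> -[u1 u2]; rewrite mem_mxline mem_line_infty /=.
by move=> /eqP-> /eqP->; rewrite mulmx0.
Qed.

(** A common nonzero vector of the two graphs is (v, Xv) with v in the kernel of X - Y. *)
Lemma skew_mxline X Y : skew_lines (mxline X) (mxline Y) = (X - Y \in unitmx).
Proof.
apply/idP/idP => [/skew_linesP sk|XYu].
  (* [det0P] yields a row vector killed by right multiplication, hence the transposes. *)
  rewrite -unitmx_tr unitmxE unitfE; apply/negP=> /det0P[v nz_v vXY].
  have eqv : X *m v^T = Y *m v^T.
    apply/eqP; rewrite -subr_eq0 -mulmxBl -[X - Y]trmxK -trmx_mul vXY.
    by rewrite trmx0.
  have /(congr1 fst)/= v0 : (v^T, X *m v^T) = 0 :> ambient K.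
    by apply: sk; rewrite mem_mxline //= eqv.
  by rewrite -(trmxK v) v0 trmx0 eqxx in nz_v.
apply/skew_linesP=> -[u1 u2]; rewrite !mem_mxline /= => /eqP-> /eqP eqXY.
have : (X - Y) *m u1 = 0 by rewrite mulmxBl eqXY subrr.
move/(congr1 (mulmx (invmx (X - Y)))); rewrite mulKmx // mulmx0 => ->.
by rewrite mulmx0.
Qed.

Lemma is_line_mxline X : is_line (mxline X).
Proof.
rewrite /is_line limg_dim_eq ?dimvf //.
suff -> : lker (linfun (graph_map X)) = 0%VS by rewrite capv0.
apply/eqP; rewrite -subv0; apply/subvP=> v; rewrite memv_ker lfunE memv0.
by move=> /eqP/(congr1 fst)/= ->.
Qed.

Lemma line_sum L L' : is_line L -> is_line L' -> skew_lines L L' ->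
  (L + L' = fullv)%VS.
Proof.
move=> /eqP dL /eqP dL' /eqP sk; apply/eqP.
by rewrite eqEdim subvf dimv_disjoint_sum // dL dL' dimvf.
Qed.

Lemma is_line_infty : is_line (line_infty K).
Proof.
rewrite /is_line limg_dim_eq ?dimvf //.
suff -> : lker (linfun (@infty_map K)) = 0%VS by rewrite capv0.
apply/eqP; rewrite -subv0; apply/subvP=> v; rewrite memv_ker lfunE memv0.
by move=> /eqP/(congr1 snd)/= ->.
Qed.

(** Such a line is a complement of L_oo, so every v is the first component of some vector of L. The
    columns of X are the second components of lifts of the two basis vectors. *)
Lemma skew_infty_mxline L : is_line L -> skew_lines L (line_infty K) ->
  exists X, L = mxline X.
Proof.
move=> lL sk.
have lift v : exists2 x, x \in L & x.1 = v.
  have : ((v, 0) : ambient K) \in (L + line_infty K)%VS.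
    by rewrite line_sum ?memvf ?is_line_infty.
  case/memv_addP=> x xL [y]; rewrite mem_line_infty => /eqP y0 /(congr1 fst)/=.
  by rewrite y0 addr0 => ->; exists x.
have [x0 x0L x01] := lift (delta_mx 0 0).
have [x1 x1L x11] := lift (delta_mx 1 0).
pose X : 'M[K]_2 := \matrix_(i, j) (if j == 0 then x0.2 i 0 else x1.2 i 0).
have sub v : ((v, X *m v) : ambient K) \in L.
  suff -> : (v, X *m v) = v 0 0 *: x0 + v 1 0 *: x1 :> ambient K.
    by rewrite rpredD ?rpredZ.
  have vE : v = v 0 0 *: delta_mx 0 0 + v 1 0 *: delta_mx 1 0.
    rewrite {1}(matrix_sum_delta v) big_ord_recl big_ord1 !big_ord1.
    by congr (_ *: _ + v _ _ *: delta_mx _ _); apply: val_inj.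
  congr pair; first by rewrite /= x01 x11.
  rewrite {1}vE mulmxDr -!scalemxAr -!colE; congr (_ *: _ + _ *: _).
    by apply/colP=> i; rewrite !mxE.
  by apply/colP=> i; rewrite !mxE.
(* A vector u of L differs from (u.1, X u.1) by a vector of L that also lies on L_oo, which is
   therefore zero. *)
exists X; apply/vspaceP=> u; rewrite mem_mxline; apply/idP/eqP=> [uL|uE].
  have /skew_linesP/(_ (u - (u.1, X *m u.1))) := sk.
  rewrite rpredB ?sub // mem_line_infty /= subrr eqxx => /(_ isT isT)/(congr1 snd)/=.
  by move/eqP; rewrite subr_eq0 => /eqP.
by have := sub u.1; rewrite -uE; case: (u).
Qed.

Lemma pairwise_skewP (s : seq {vspace ambient K}) L L' :
  pairwise_skew s -> L \in s -> L' \in s -> L != L' -> skew_lines L L'.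
Proof.
case/andP=> _ /(pairwiseP 0%VS) sk Ls L's neq.
have [|lt|eq] := ltngtP (index L s) (index L' s).
- by move/sk; rewrite !inE !index_mem !nth_index // => ->.
- rewrite skew_linesC; have := sk _ _ _ _ lt.
  by rewrite !inE !index_mem !nth_index // => ->.
- by case/eqP: neq; rewrite -(nth_index 0%VS Ls) eq nth_index.
Qed.

Lemma pairwise_skew_line (s : seq {vspace ambient K}) L :
  pairwise_skew s -> L \in s -> is_line L.
Proof. by case/andP=> /allP lines _; apply: lines. Qed.

(** * Points of lines and perspectivities *)

Lemma pointE {L} (p : point L) u : u \in val p -> u != 0 -> val p = <[u]>%VS.
Proof.
case: p => V /= /andP[_ /eqP dV] uV nz_u; apply/esym/eqP.
by rewrite eqEdim -memvE uV dim_vline nz_u dV.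
Qed.

Lemma point_gen {L} (p : point L) :
  exists u, [/\ u \in L, u != 0 & val p = <[u]>%VS].
Proof.
have [pL /eqP dp] := andP (valP p).
have nz_p : vpick (val p) != 0 by rewrite vpick0 -dimv_eq0 dp.
exists (vpick (val p)); split => //; last exact/pointE/nz_p/memv_pick.
exact/(subvP pL)/memv_pick.
Qed.

Lemma point_of_vector {L} u : u \in L -> u != 0 ->
  exists p : point L, val p = <[u]>%VS.
Proof.
move=> uL nz_u; have Pu : (<[u]> <= L)%VS && (\dim <[u]> == 1%N).
  by rewrite -memvE uL dim_vline nz_u.
by exists (exist _ <[u]>%VS Pu).
Qed.

(** The point p is not on Lk, so p + Lk has dimension 3 and spans everything together with Lj; it
    meets Lj in dimension 2 + 3 - 4 = 1. *)
Lemma perspectivity_exists {Li Lj Lk : {vspace ambient K}} :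
  is_line Lj -> is_line Lk -> skew_lines Li Lk -> skew_lines Lj Lk ->
  exists f : point Li -> point Lj,
    forall p, val (f p) = (Lj :&: (val p + Lk))%VS.
Proof.
move=> lj lk skik skjk.
have P (p : point Li) : (Lj :&: (val p + Lk) <= Lj)%VS &&
    (\dim (Lj :&: (val p + Lk)) == 1)%N.
  rewrite capvSl /=; have [pL /eqP dp] := andP (valP p).
  have pk : (Lk :&: val p = 0)%VS.
    by apply/eqP; rewrite capvC -subv0 -(eqP skik) capvS.
  have full : (Lj + (Lk + val p) = fullv)%VS.
    apply/eqP; rewrite eqEsubv subvf -(line_sum _ _ lj lk skjk).
    by rewrite addvS ?subvv ?addvSl.
  have := dimv_sum_cap Lj (Lk + val p).
  rewrite full dimvf (dimv_disjoint_sum pk) dp.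
  rewrite (eqP lj) (eqP lk) => /eqP.
  by rewrite (addvC (val p)) -[(2 + _)%N]/(4 + 1)%N eqn_add2l.
by exists (fun p => exist _ (Lj :&: (val p + Lk))%VS (P p)).
Qed.

(** A generator of f p has the form w = a u + l with u spanning p and l in Lk. Here a is nonzero,
    since otherwise w would lie on both Lj and Lk; solving for u puts p in f p + Lk, and both sides
    are points. *)
Lemma perspectivityK {Li Lj Lk : {vspace ambient K}}
    (f : point Li -> point Lj) (g : point Lj -> point Li) :
  skew_lines Lj Lk ->
  (forall p, val (f p) = (Lj :&: (val p + Lk))%VS) ->
  (forall p, val (g p) = (Li :&: (val p + Lk))%VS) ->
  g \o f = id.
Proof.
move=> /skew_linesP sk fE gE; apply: functional_extensionality => p /=.
apply: val_inj; apply/esym/eqP; have [pL /eqP dp] := andP (valP p).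
have [_ /eqP dg] := andP (valP (g (f p))).
rewrite eqEdim [\dim _]dg [\dim _]dp leqnn andbT gE subv_cap pL /=.
have [w [wL nz_w wE]] := point_gen (f p); have [u [uL nz_u uE]] := point_gen p.
rewrite uE -memvE wE.
have : w \in val (f p) by rewrite wE memv_line.
rewrite fE memv_cap wL uE => /memv_addP[_ /vlineP[a ->] [l lk wE']].
have nz_a : a != 0.
  by apply: contraNneq nz_w => a0; rewrite (sk w) // wE' a0 scale0r add0r.
have -> : u = a^-1 *: w - a^-1 *: l.
  by rewrite -scalerBr wE' addrK scalerA mulVf // scale1r.
apply: memv_add; first by rewrite memvZ ?memv_line.
by rewrite rpredN rpredZ.
Qed.

(** * Matrices representing maps between lines *)

(* Injective on L only when L is equal or skew to L_oo. *)
Definition crd L u : 'cV[K]_2 := if L == line_infty K then u.2 else u.1.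

Lemma crd_infty u : crd (line_infty K) u = u.2.
Proof. by rewrite /crd eqxx. Qed.

Lemma crd_mxline X u : crd (mxline X) u = u.1.
Proof. by rewrite /crd (negbTE (mxline_neq_infty X)). Qed.

Lemma crdZ L a u : crd L (a *: u) = a *: crd L u.
Proof. by rewrite /crd; case: ifP. Qed.

(** Speaking of all vectors of p avoids choosing generators. As w may vanish, the zero matrix
    represents every map; this is why invertibility is assumed wherever a matrix has to determine a
    map. *)
Definition represents A {L L' : {vspace ambient K}} (f : point L -> point L') :=
  forall (p : point L) u, u \in val p ->
  exists2 w, w \in val (f p) & crd L' w = A *m crd L u.

Lemma represents_id L : represents 1%:M (@id (point L)).
Proof. by move=> p u up; exists u; rewrite ?mul1mx. Qed.

Lemma represents_comp {L1 L2 L3 : {vspace ambient K}} {A B}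
    {f : point L1 -> point L2} {g : point L2 -> point L3} :
  represents A f -> represents B g -> represents (B *m A) (g \o f).
Proof.
move=> rf rg p u /rf[w /rg[x xg xE] wE].
by exists x => //; rewrite xE wE mulmxA.
Qed.

Lemma representsZ {L L' : {vspace ambient K}} A a {f : point L -> point L'} :
  represents A f -> represents (a *: A) f.
Proof.
move=> rf p u /rf[w wf wE]; exists (a *: w); first exact: rpredZ.
by rewrite crdZ wE scalemxAl.
Qed.

(** A vector of Lj congruent to u modulo Lk lies in the plane spanned by p and Lk, so the
    computation of f becomes linear algebra on vectors. *)
Lemma represents_perspectivity {Li Lj Lk : {vspace ambient K}} A
    (f : point Li -> point Lj) :
  (forall p, val (f p) = (Lj :&: (val p + Lk))%VS) ->
  (forall u, u \in Li ->
     exists w, [/\ w \in Lj, w - u \in Lk & crd Lj w = A *m crd Li u]) ->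
  represents A f.
Proof.
move=> fE wit p u up; have [pL _] := andP (valP p).
have [w [wj wk wE]] := wit u (subvP pL _ up).
exists w => //; rewrite fE memv_cap wj /= -(subrK u w) addrC.
exact: memv_add.
Qed.

(** The two basis vectors make A diagonal, and their sum makes the diagonal entries equal. *)
Lemma scalar_of_eigenvectors A :
  (forall v : 'cV_2, v != 0 -> exists a, A *m v = a *: v) ->
  exists a, A = a%:M.
Proof.
have ord2 (i : 'I_2) : i = 0 \/ i = 1.
  by case: i => -[|[|//]] lt; [left | right]; apply: val_inj.
move=> eig; pose v (x y : K) : 'cV_2 := \col_i (if i == 0 then x else y).
have nz_v x y : (x != 0) || (y != 0) -> v x y != 0.
  move=> nz; apply: contraTneq nz => /colP eq0.
  by have := (eq0 0, eq0 1); rewrite !mxE /= => -[-> ->]; rewrite eqxx.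
have [a0 /colP e0] := eig (v 1 0) (nz_v 1 0 ltac:(by rewrite oner_neq0)).
have [a1 /colP e1] := eig (v 0 1) (nz_v 0 1 ltac:(by rewrite oner_neq0 orbT)).
have [a /colP e] := eig (v 1 1) (nz_v 1 1 ltac:(by rewrite oner_neq0)).
have := (e0 0, e0 1, (e1 0, e1 1), (e 0, e 1)).
rewrite !mxE !big_ord_recl !big_ord0 !mxE /= !mulr1 !mulr0 !addr0 !add0r.
rewrite (_ : lift 0 0 = 1 :> 'I_2); last exact: val_inj.
move=> [[[A00 A10] [A01 A11]] [Aa0 Aa1]].
exists a; apply/matrixP=> i j; rewrite !mxE.
have [-> | ->] := ord2 i; have [-> | ->] := ord2 j; rewrite ?A10 ?A01 //=.
  by rewrite -Aa0 A01 addr0.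
by rewrite -Aa1 A10 add0r.
Qed.

(** For every nonzero v, both A v and B v are coordinates of vectors in the same point, and B v is
    nonzero. Hence every nonzero vector is an eigenvector of B^-1 A. *)
Lemma represents_uniq A B (f : point (mxline 0) -> point (mxline 0)) :
  B \in unitmx -> represents A f -> represents B f -> exists a, A = a *: B.
Proof.
move=> Bu rA rB; suff [a aE] : exists a, invmx B *m A = a%:M.
  by exists a; rewrite -[A](mulKVmx Bu) aE mul_mx_scalar.
apply: scalar_of_eigenvectors => v nz_v.
have [||p pE] := @point_of_vector (mxline 0) (v, 0).
- by rewrite mem_mxline mul0mx.
- by apply: contraNneq nz_v => /(congr1 fst)/= ->.
have vp : ((v, 0) : ambient K) \in val p by rewrite pE memv_line.
have [wA wAp] := rA p _ vp; have [wB wBp] := rB p _ vp.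
rewrite !crd_mxline /= => wBE wAE.
have nz_wB : wB != 0.
  apply: contraNneq nz_v => wB0.
  by rewrite -[v](mulKmx Bu) -wBE wB0 mulmx0.
move: wAp; rewrite (pointE _ _ wBp nz_wB) => /vlineP[a wAB].
exists a; rewrite -mulmxA -wAE wAB /= wBE -scalemxAr mulKmx //.
Qed.

(** A vector of L_0 is determined by its first component, and an invertible A sends a generator of p
    to a nonzero vector, which spans the image. With the preceding uniqueness, this lets loops at
    L_0 be handled as elements of PGL_2. *)
Lemma represents_inj A (f g : point (mxline 0) -> point (mxline 0)) :
  A \in unitmx -> represents A f -> represents A g -> f = g.
Proof.
move=> Au rf rg; apply: functional_extensionality => p; apply: val_inj.
have [u [uL nz_u pE]] := point_gen p.
have up : u \in val p by rewrite pE memv_line.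
have nz_u1 : u.1 != 0.
  apply: contraNneq nz_u => u10; move: uL; rewrite mem_mxline u10 mulmx0.
  by case: u u10 {up pE} => /= u1 u2 -> /eqP->.
have [w wf wE] := rf p u up; have [x xg xE] := rg p u up.
rewrite !crd_mxline in wE xE.
have eqwx : w = x.
  have := (subvP (proj1 (andP (valP (f p)))) w wf,
    subvP (proj1 (andP (valP (g p)))) x xg).
  rewrite !mem_mxline !mul0mx => -[/eqP w2 /eqP x2].
  by rewrite (surjective_pairing w) (surjective_pairing x) w2 x2 wE xE.
have nz_w : w != 0.
  by apply: contraNneq nz_u1 => w0; rewrite -[u.1](mulKmx Au) -wE w0 mulmx0.
by rewrite (pointE _ _ wf nz_w) eqwx -(pointE _ _ xg) // -eqwx.
Qed.

(** * Matrices of the perspectivities *)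

Definition skew_family (S : pred {vspace ambient K}) :=
  (forall L, S L -> is_line L) /\
  (forall L L', S L -> S L' -> L != L' -> skew_lines L L').

Lemma pairwise_skew_family (s : seq {vspace ambient K}) :
  pairwise_skew s -> skew_family (mem s).
Proof.
move=> sk; split=> [L|L L']; first exact: pairwise_skew_line.
exact: pairwise_skewP.
Qed.

Lemma represents_to_infty X Z (f : point (mxline X) -> point (line_infty K)) :
  (forall p, val (f p) = (line_infty K :&: (val p + mxline Z))%VS) ->
  represents (X - Z) f.
Proof.
move=> fE; apply: (represents_perspectivity _ _ fE) => -[u1 u2].
rewrite mem_mxline => /= /eqP->; exists (0, (X - Z) *m u1).
rewrite mem_line_infty mem_mxline crd_infty crd_mxline /= eqxx; split=> //.
by rewrite add0r mulmxN mulmxBl addrAC subrr add0r.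
Qed.

Lemma represents_from_infty Y Z (f : point (line_infty K) -> point (mxline Y)) :
  Y - Z \in unitmx ->
  (forall p, val (f p) = (mxline Y :&: (val p + mxline Z))%VS) ->
  represents (invmx (Y - Z)) f.
Proof.
move=> YZu fE; apply: (represents_perspectivity _ _ fE) => -[u1 u2].
rewrite mem_line_infty => /= /eqP->.
exists (invmx (Y - Z) *m u2, Y *m (invmx (Y - Z) *m u2)).
rewrite !mem_mxline crd_infty crd_mxline /= eqxx; split=> //.
by rewrite subr0 subr_eq [_ + u2]addrC -subr_eq -mulmxBl mulKVmx.
Qed.

Lemma represents_through_infty X Y (f : point (mxline X) -> point (mxline Y)) :
  (forall p, val (f p) = (mxline Y :&: (val p + line_infty K))%VS) ->
  represents 1%:M f.
Proof.
move=> fE; apply: (represents_perspectivity _ _ fE) => -[u1 u2] _.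
exists (u1, Y *m u1); rewrite mem_mxline mem_line_infty !crd_mxline /=.
by rewrite subrr !eqxx mul1mx.
Qed.

(** The image (v, Yv) of (u, Xu) must satisfy Yv - Xu = Z(v - u), that is (Y - Z)v = (X - Z)u. *)
Lemma represents_mxline X Y Z (f : point (mxline X) -> point (mxline Y)) :
  Y - Z \in unitmx ->
  (forall p, val (f p) = (mxline Y :&: (val p + mxline Z))%VS) ->
  represents (invmx (Y - Z) *m (X - Z)) f.
Proof.
move=> YZu fE; apply: (represents_perspectivity _ _ fE) => -[u1 u2].
rewrite mem_mxline => /= /eqP->.
set v := invmx (Y - Z) *m (X - Z) *m u1; exists (v, Y *m v).
rewrite !mem_mxline !crd_mxline /= eqxx; split=> //.
have : (Y - Z) *m v = (X - Z) *m u1 by rewrite /v -mulmxA mulKVmx.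
rewrite mulmxBr !mulmxBl => /(canRL (subrK _)) ->.
by apply/eqP; rewrite addrC !addrA addNr add0r addrC.
Qed.

(** Induction on arrows: a class P of invertible matrices that is closed under the group operations
    and contains the differences of the matrices of the lines represents every arrow. It is used
    with P the nonzero scalars, and with P the nonzero multiples of powers of M. *)
Lemma arrow_represents (P Q : 'M[K]_2 -> Prop) (S : {fset {vspace ambient K}}) :
  P 1%:M -> (forall A B, P A -> P B -> P (A *m B)) ->
  (forall A, P A -> A \in unitmx /\ P (invmx A)) ->
  (forall X Y, Q X -> Q Y -> X != Y -> P (X - Y)) ->
  (forall L, L \in S -> L = line_infty K \/ exists2 X, Q X & L = mxline X) ->
  forall Li Lj (f : point Li -> point Lj), arrow S f ->
  exists2 A, P A & represents A f.
Proof.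
move=> P1 PM PV PQ QS Li Lj f; elim=> {Li Lj f}; last first.
  move=> Li Lj Lk f g _ [A PA rA] _ [B PB rB].
  by exists (B *m A); [exact: PM | exact: represents_comp].
move=> Li Lj Lk f /QS Si /QS Sj /QS Sk; rewrite /= !inE negb_or andbT.
(* Distinctness allows at most one of the three lines to be L_oo: the source, the target, the
   centre, or none, in this order. *)
case: Si => [|[X QX]] Ei; case: Sj => [|[Y QY]] Ej; case: Sk => [|[Z QZ]] Ek;
  subst Li Lj Lk; rewrite ?eqxx ?andbF //= => /andP[/andP[neq_ij neq_ik] neq_jk] fE.
- have [] := PV _ (PQ Y Z QY QZ _); first by apply: contraNneq neq_jk => ->.
  by move=> YZu PYZ; exists (invmx (Y - Z)) => //; apply: represents_from_infty.
- exists (X - Z); last exact: represents_to_infty.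
  by apply: PQ => //; apply: contraNneq neq_ik => ->.
- by exists 1%:M => //; apply: represents_through_infty fE.
have [] := PV _ (PQ Y Z QY QZ _); first by apply: contraNneq neq_jk => ->.
move=> YZu PYZ; exists (invmx (Y - Z) *m (X - Z)); last exact: represents_mxline.
by apply: PM => //; apply: PQ => //; apply: contraNneq neq_ik => ->.
Qed.

(** * Arrows and vertex groups of a skew family *)

Section Family.
Context (S : {fset {vspace ambient K}}) (skS : skew_family (mem S)).

Lemma arrow_perspectivity Li Lj Lk :
  Li \in S -> Lj \in S -> Lk \in S -> uniq [:: Li; Lj; Lk] ->
  exists2 f : point Li -> point Lj, arrow S f &
    forall p, val (f p) = (Lj :&: (val p + Lk))%VS.
Proof.
case: skS => lineS skewS Si Sj Sk un.
have [] : [/\ Li != Lj, Li != Lk & Lj != Lk].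
  by move: un; rewrite /= !inE negb_or andbT => /andP[/andP[]].
move=> neq_ij neq_ik neq_jk.
have [f fE] := @perspectivity_exists Li Lj Lk (lineS _ Sj) (lineS _ Sk)
  (skewS _ _ Si Sk neq_ik) (skewS _ _ Sj Sk neq_jk).
by exists f => //; apply: arrow_gen fE.
Qed.

(** The perspectivities in both directions from the same centre Lk are mutually inverse. *)
Lemma arrow_iso Li Lj Lk :
  Li \in S -> Lj \in S -> Lk \in S -> uniq [:: Li; Lj; Lk] ->
  exists f : point Li -> point Lj, exists g : point Lj -> point Li,
    [/\ arrow S f, arrow S g, g \o f = id & f \o g = id].
Proof.
move=> Si Sj Sk un.
have [] : [/\ Li != Lj, Li != Lk & Lj != Lk].
  by move: un; rewrite /= !inE negb_or andbT => /andP[/andP[]].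
move=> neq_ij neq_ik neq_jk.
have [f Sf fE] := arrow_perspectivity _ _ _ Si Sj Sk un.
have un' : uniq [:: Lj; Li; Lk].
  by rewrite /= !inE negb_or eq_sym neq_ij neq_ik neq_jk.
have [g Sg gE] := arrow_perspectivity _ _ _ Sj Si Sk un'.
have [_ skewS] := skS; exists f, g; split => //.
  exact: perspectivityK f g (skewS _ _ Sj Sk neq_jk) fE gE.
exact: perspectivityK g f (skewS _ _ Si Sk neq_ik) gE fE.
Qed.

Lemma arrow_id Li Lj Lk :
  Li \in S -> Lj \in S -> Lk \in S -> uniq [:: Li; Lj; Lk] ->
  arrow S (@id (point Li)).
Proof.
move=> Si Sj Sk un; have [f [g [Sf Sg gfK _]]] := arrow_iso _ _ _ Si Sj Sk un.
by rewrite -gfK; apply: arrow_comp.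
Qed.

Lemma arrow_iter L (f : point L -> point L) n :
  arrow S (@id (point L)) -> arrow S f -> arrow S (iter n f).
Proof.
by move=> Sid Sf; elim: n => [//|n IHn]; apply: (@arrow_comp _ _ _ _ _ (iter n f) f).
Qed.

(** The loop goes from L_0 to the line of X with centre L_oo, on to L_oo with centre the line of Y,
    and back to L_0 with centre the line of I. Its matrix is (0 - I)^-1 (X - Y) I, and the sign is
    removed by rescaling. *)
Lemma mxline_loop X Y :
  mxline 0 \in S -> line_infty K \in S -> mxline 1%:M \in S ->
  mxline X \in S -> mxline Y \in S -> X != 0 -> X != Y ->
  exists2 f : point (mxline 0) -> point (mxline 0), arrow S f &
    represents (X - Y) f.
Proof.
move=> S0 Soo S1 SX SY nz_X neqXY.
have neq_oo Z : (mxline Z == line_infty K) = false.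
  exact/negbTE/mxline_neq_infty.
have neq_oo' Z : (line_infty K == mxline Z) = false by rewrite eq_sym.
have mx_eq := inj_eq mxline_inj.
have nz1 : 0 != 1%:M :> 'M[K]_2 by rewrite eq_sym oner_eq0.
have unf : uniq [:: mxline 0; mxline X; line_infty K].
  by rewrite /= !inE !neq_oo mx_eq orbF eq_sym nz_X.
have ung : uniq [:: mxline X; line_infty K; mxline Y].
  by rewrite /= !inE neq_oo neq_oo' mx_eq neqXY.
have unh : uniq [:: line_infty K; mxline 0; mxline 1%:M].
  by rewrite /= !inE !neq_oo' mx_eq nz1.
have [f Sf fE] := arrow_perspectivity _ _ _ S0 SX Soo unf.
have [g Sg gE] := arrow_perspectivity _ _ _ SX Soo SY ung.
have [h Sh hE] := arrow_perspectivity _ _ _ Soo S0 S1 unh.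
exists (h \o (g \o f)); first by apply: arrow_comp => //; apply: arrow_comp.
have invE : invmx (0 - 1%:M) = (-1)%:M :> 'M[K]_2.
  by rewrite sub0r -scaleN1r scalemx1 invmx_scalar invrN1.
have N1u : 0 - 1%:M \in @unitmx K 2.
  rewrite sub0r -scaleN1r scalemx1 unitmxE det_scalar unitfE.
  by rewrite expf_neq0 // oppr_eq0 oner_neq0.
have rh := represents_from_infty _ _ _ N1u hE; rewrite invE in rh.
have := representsZ _ (-1) (represents_comp
  (represents_comp (represents_through_infty _ _ _ fE)
    (represents_to_infty _ _ _ gE)) rh).
by rewrite mulmx1 mul_scalar_mx scalerA mulrNN mul1r scale1r.
Qed.

Lemma G_isog_vertex (gT : finGroupType) L0 :
  (forall L, L \in S -> L != L0 ->
     exists a : point L0 -> point L, exists b : point L -> point L0,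
       [/\ arrow S a, arrow S b, b \o a = id & a \o b = id]) ->
  (exists phi : gT -> (point L0 -> point L0),
    [/\ forall x y, phi (x * y)%g = phi x \o phi y,
        injective phi
      & forall f, arrow S f <-> exists x, phi x = f]) ->
  G_isog S gT.
Proof.
move=> isoL vertex0 L SL; have [->|neqL] := eqVneq L L0; first exact: vertex0.
have [phi [phiM phi_inj phiE]] := vertex0.
have [a [b [Sa Sb abK baK]]] := isoL L SL neqL.
have abp p : b (a p) = p by have := congr1 (@^~ p) abK.
have bap p : a (b p) = p by have := congr1 (@^~ p) baK.
exists (fun x => a \o (phi x \o b)); split.
- move=> x y; apply: functional_extensionality => p.
  by rewrite phiM /= abp.
- move=> x y eqxy; apply: phi_inj; apply: functional_extensionality => p.
  have /(congr1 b) := congr1 (@^~ (a p)) eqxy.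
  by rewrite /= !abp.
move=> f; split=> [Sf|[x <-]].
  have /phiE[x xE] : arrow S (b \o (f \o a)).
    by apply: arrow_comp Sb; apply: arrow_comp Sf.
  exists x; apply: functional_extensionality => p.
  by rewrite xE /= !bap.
apply: arrow_comp Sa; apply: arrow_comp Sb _.
by apply/phiE; exists x.
Qed.

Lemma vertex_group_C3 L : G_isog S 'Z_3 -> L \in S -> arrow S (@id (point L)) ->
  [/\ exists2 f : point L -> point L, arrow S f & f <> id,
      forall f : point L -> point L, arrow S f -> f \o (f \o f) = id
    & forall f g : point L -> point L, arrow S f -> arrow S g -> f <> id ->
      exists2 i, (i < 3)%N & g = iter i f].
Proof.
move=> isoS SL; have [phi [phiM phi_inj phiE]] := isoS L SL.
move=> /phiE[e phie].
(* The preimage e of the identity map is idempotent, hence trivial. *)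
have e1 : e = 1%g.
  by apply: (mulgI e); apply: phi_inj; rewrite phiM mulg1 phie.
rewrite {e}e1 in phie; split.
(* [1%R] is the residue 1, a generator; the group unit [1%g] is the residue 0. *)
- pose g : 'Z_3 := 1%R; exists (phi g); first by apply/phiE; exists g.
  by rewrite -phie => /phi_inj.
- move=> f /phiE[x <-]; rewrite -!phiM -phie; congr phi.
  by apply/eqP; case: x => -[|[|[|]]].
move=> f g /phiE[x <-] /phiE[y <-] nid.
have nx : x != 1%g by apply: contra_not_neq nid => ->.
have : [|| y == 1%g, y == x | y == (x * x)%g].
  by move: nx; case: x {nid} => -[|[|[|]]] //=; case: y => -[|[|[|]]].
case/or3P=> /eqP->; first by exists 0%N.
- by exists 1%N.
by exists 2%N; rewrite // phiM.
Qed.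

End Family.

(** * Matrix identities forced by a group of order three *)

Lemma represents_iter {L} {A} {f : point L -> point L} n :
  represents A f -> represents (A ^+ n) (iter n f).
Proof.
move=> rf; elim: n => [|n IHn]; first exact: represents_id.
by rewrite exprS; exact: represents_comp IHn rf.
Qed.

(** Linear independence of I and M, in the form used to compare coefficients. *)
Lemma scale_scalar_mx_eq0 M a b :
  (forall c, M <> c%:M) -> a *: M = b%:M -> a = 0 /\ b = 0.
Proof.
move=> nscal eqab; have a0 : a = 0.
  apply/eqP; apply: contra_notT (nscal (a^-1 * b)) => nz_a.
  by rewrite -scale_scalar_mx -eqab scalerA mulVf // scale1r.
split=> //; move/matrixP/(_ 0 0): eqab; rewrite a0 scale0r !mxE.
by rewrite mulr1n => <-.
Qed.

Lemma uniq_base_lines :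
  uniq [:: mxline (0 : 'M[K]_2); line_infty K; mxline 1%:M].
Proof.
rewrite /= !inE negb_or (inj_eq mxline_inj) (eq_sym (line_infty K)).
by rewrite !mxline_neq_infty (eq_sym 0) oner_eq0.
Qed.

(** The loop of matrix M is nontrivial because M is not scalar, so it generates the vertex group.
    Its cube is the identity, and the loop of matrix X - Y is one of its iterates; uniqueness of
    matrices up to scalars turns both facts into equations. *)
Lemma C3_differences (S : {fset {vspace ambient K}}) M :
  skew_family (mem S) -> G_isog S 'Z_3 ->
  mxline 0 \in S -> line_infty K \in S -> mxline 1%:M \in S ->
  mxline M \in S -> M \in unitmx -> (forall c, M <> c%:M) ->
  (exists d, M ^+ 3 = d%:M) /\
  forall X Y, mxline X \in S -> mxline Y \in S -> X != 0 -> X != Y ->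
    exists i, exists c, [/\ (i < 3)%N, c != 0 & X - Y = c *: M ^+ i].
Proof.
move=> skS isoS S0 Soo S1 SM Mu nscal.
have nz_M : M != 0 by apply/eqP => M0; apply: (nscal 0); rewrite M0 raddf0.
have loop X Y := mxline_loop S skS X Y S0 Soo S1.
have Sid : arrow S (@id (point (mxline (0 : 'M[K]_2)))).
  exact: arrow_id S skS _ _ _ S0 Soo S1 uniq_base_lines.
have [_ C3cube C3gen] := vertex_group_C3 _ _ isoS S0 Sid.
have [f Sf] := loop M 0 SM S0 nz_M nz_M; rewrite subr0 => rf.
have nid : f <> id.
  move=> fE; have [] := represents_uniq M 1%:M f; rewrite ?unitmx1 //.
    by rewrite fE; apply: represents_id.
  by move=> a; rewrite scalemx1 => /nscal.
split.
  have rf3 := represents_comp (represents_comp rf rf) rf.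
  have [] := represents_uniq (M ^+ 3) 1%:M id; rewrite ?unitmx1 //.
  - by rewrite -(C3cube f Sf).
  - exact: represents_id.
  by move=> a; rewrite scalemx1 => ->; exists a.
move=> X Y SX SY nz_X neqXY; have [g Sg rg] := loop X Y SX SY nz_X neqXY.
have [i lti gE] := C3gen f g Sf Sg nid.
have rg' : represents (M ^+ i) g by rewrite gE; apply: represents_iter.
have [|a aE] := represents_uniq (X - Y) (M ^+ i) g _ rg rg'.
  exact: unitrX.
exists i, a; split=> //; apply: contraNneq neqXY => a0.
by rewrite -subr_eq0 aE a0 scale0r.
Qed.

(** For i = 0, M would be scalar; for i = 1, (1 - c) M = I is impossible. For i = 2, multiplying by
    M gives M^2 = M + cd, and substituting back gives (1 - c) M = 1 + c^2 d, so c = 1 and d = -1. *)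
Lemma order3_quadratic M c d i : (forall c, M <> c%:M) -> M ^+ 3 = d%:M ->
  (i < 3)%N -> M - 1 = c *: M ^+ i -> M ^+ 2 = M - 1.
Proof.
move=> nscal M3; case: i => [|[|[|//]]] _ E.
- by case: (nscal (c + 1)); rewrite raddfD /= -scalemx1 -[1%:M]/1 -E subrK.
- have [] := scale_scalar_mx_eq0 M (1 - c) 1 nscal.
    by rewrite scalerBl scale1r -E opprB addrC subrK.
  by move=> _ /eqP; rewrite oner_eq0.
have M2 : M ^+ 2 = M + (c * d)%:M.
  rewrite -(subrK M (M ^+ 2)) addrC; congr (_ + _).
  have : M * (M - 1) = c *: M ^+ 3 by rewrite E -scalerAr -exprS.
  by rewrite mulrBr mulr1 -expr2 M3 => ->; rewrite scale_scalar_mx.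
have [] := scale_scalar_mx_eq0 M (1 - c) (1 + c * (c * d)) nscal.
  have ME : M = c *: M + (c * (c * d))%:M + 1.
    by rewrite -[LHS](subrK 1) E M2 scalerDr scale_scalar_mx.
  by rewrite scalerBl scale1r raddfD /= {1}ME addrC !addrA addNr add0r addrC.
move=> /eqP; rewrite subr_eq0 => /eqP c1; rewrite -c1 !mul1r => cd.
by rewrite M2 -c1 mul1r -[d](addKr 1) cd addr0 raddfN.
Qed.

(** With N = x I + y M, the differences have coordinates (x, y), (x - 1, y) and (x, y - 1) in the
    basis (I, M), and each must lie along (1, 0), (0, 1) or (-1, 1). *)
Lemma fifth_line M N : (forall c, M <> c%:M) -> M ^+ 2 = M - 1 ->
  (forall Y, Y \in [:: 0; 1; M] ->
    exists i, exists c, [/\ (i < 3)%N, c != 0 & N - Y = c *: M ^+ i]) ->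
  N = 1 - M /\ 2%:R = 0 :> K.
Proof.
move=> nscal M2 diffs.
(* T x y: x I + y M is a nonzero multiple of I, M or M^2 = M - I. *)
pose T (x y : K) := [|| (x != 0) && (y == 0), (x == 0) && (y != 0)
                      | (y != 0) && (x + y == 0)].
have TP i c : (i < 3)%N -> c != 0 -> exists x, exists y,
    T x y /\ c *: M ^+ i = x%:M + y *: M.
  case: i => [|[|[|//]]] _ nz_c.
  - exists c, 0; split; first by rewrite /T nz_c eqxx.
    by rewrite scale0r addr0 -scalemx1.
  - exists 0, c; split; first by rewrite /T nz_c eqxx orbT.
    by rewrite raddf0 add0r.
  exists (- c), c; rewrite /T nz_c addNr eqxx !orbT; split=> //.
  by rewrite M2 scalerBr addrC -[1]/(1%:M) scalemx1 raddfN.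
have uniq_xy x y x' y' : x%:M + y *: M = x'%:M + y' *: M -> x = x' /\ y = y'.
  move=> E; have [] := scale_scalar_mx_eq0 M (y - y') (x' - x) nscal.
    rewrite scalerBl raddfB /=; apply/eqP; rewrite subr_eq addrAC -E.
    by rewrite addrAC subrr add0r.
  by move=> /eqP; rewrite subr_eq0 => /eqP-> /eqP; rewrite subr_eq0 => /eqP->.
have diffT Y : Y \in [:: 0; 1; M] -> exists x, exists y,
    T x y /\ N - Y = x%:M + y *: M.
  by move=> /diffs[i [c [lti nz_c ->]]]; apply: TP.
have [|x [y [Txy NE]]] := diffT 0; first by rewrite inE eqxx.
have [|x1 [y1 [T1 N1E]]] := diffT 1; first by rewrite !inE eqxx orbT.
have [|x2 [y2 [T2 N2E]]] := diffT M; first by rewrite !inE eqxx !orbT.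
rewrite subr0 in NE.
have [x1E y1E] : x - 1 = x1 /\ y = y1.
  by apply: uniq_xy; rewrite -N1E NE raddfB /= addrAC.
have [x2E y2E] : x = x2 /\ y - 1 = y2.
  by apply: uniq_xy; rewrite -N2E NE scalerBl scale1r addrA.
subst x1 y1 x2 y2; have nz1 : (1 : K) != 0 := oner_neq0 K.
have T00 : T 0 0 = false by rewrite /T eqxx.
have N1 : (-1 == 0 :> K) = false by rewrite oppr_eq0 (negbTE nz1).
case/or3P: Txy (Txy) => /andP[].
(* N is a multiple of I: the difference with M forces N = I, so N - I vanishes. *)
- move=> nz_x /eqP y0; rewrite y0 in T1 T2 *.
  move: T2; rewrite /T sub0r oppr_eq0 nz1 (negbTE nz_x) (negbTE nz1) /=.
  rewrite subr_eq0 => /eqP x1.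
  by move: T1; rewrite x1 subrr T00.
(* N is a multiple of M: the difference with I forces N = M, so N - M vanishes. *)
- move=> /eqP x0 nz_y; rewrite x0 in T1 T2 *.
  move: T1; rewrite /T sub0r oppr_eq0 nz1 nz_y (negbTE nz_y) (negbTE nz1) /=.
  rewrite addrC subr_eq0 => /eqP y1.
  by move: T2; rewrite y1 subrr T00.
(* N is a multiple of M - I: the difference with I gives N = I - M, and then N - M = I - 2M is
   admissible only if 2 = 0. *)
move=> nz_y /eqP xy0 _.
have x1 : x = 1.
  move: T1; rewrite /T (negbTE nz_y) addrAC xy0 sub0r N1 /= andbF andbT orbF.
  by rewrite subr_eq0 => /eqP.
rewrite x1 in xy0 T2 NE; have yN1 : y = -1 by rewrite -[y](addKr 1) xy0 addr0.
split; first by rewrite NE yN1 scaleN1r.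
move: T2; rewrite /T yN1 (negbTE nz1) /= addrA subrr sub0r N1 andbF orbF.
by rewrite -opprD oppr_eq0 => /eqP.
Qed.

(** If M were scalar, all differences would be scalar, so every loop at L_0 would be the identity
    and the group trivial. *)
Lemma C3_nonscalar (S : {fset {vspace ambient K}}) M :
  skew_family (mem S) -> G_isog S 'Z_3 -> S =i four_lines M ->
  forall c, M <> c%:M.
Proof.
move=> skS isoS SE c Mc.
have S0 : mxline 0 \in S by rewrite SE inE eqxx.
have Soo : line_infty K \in S by rewrite SE !inE eqxx orbT.
have S1 : mxline 1%:M \in S by rewrite SE !inE eqxx !orbT.
have Sid := arrow_id S skS _ _ _ S0 Soo S1 uniq_base_lines.
have [[f Sf nid] _ _] := vertex_group_C3 _ _ isoS S0 Sid; apply: nid.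
have [|||||A [a nz_a ->] rf] := arrow_represents
  (fun A => exists2 a, a != 0 & A = a%:M) (fun X => exists b, X = b%:M)
  S _ _ _ _ _ _ _ f Sf.
- by exists 1; rewrite ?oner_neq0.
- move=> A B [a nz_a ->] [b nz_b ->]; exists (a * b); first by rewrite mulf_neq0.
  by rewrite scalar_mxM.
- move=> A [a nz_a ->]; rewrite unitmxE det_scalar unitfE expf_neq0 //.
  by split=> //; exists a^-1; rewrite ?invr_eq0 // invmx_scalar.
- move=> X Y [a ->] [b ->] neqab; exists (a - b); last by rewrite raddfB.
  by rewrite subr_eq0; apply: contraNneq neqab => ->.
- move=> L; rewrite SE !inE => /or4P[] /eqP->; [right | by left | right | right].
  + by exists 0 => //; exists 0; rewrite raddf0.
  + by exists 1%:M => //; exists 1.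
  by exists M => //; exists c.
apply: represents_inj rf _.
  by rewrite unitmxE det_scalar unitfE expf_neq0.
by rewrite -scalemx1; apply: representsZ; apply: represents_id.
Qed.

(** * The fifth line in characteristic two *)

Lemma arrow_subset (S S' : {fset {vspace ambient K}}) :
  {subset S <= S'} ->
  forall Li Lj (f : point Li -> point Lj), arrow S f -> arrow S' f.
Proof.
move=> sSS' Li Lj f; elim=> {Li Lj f}
  [Li Lj Lk f Si Sj Sk un fE|Li Lj Lk f g _ S'f _ S'g].
  exact: arrow_gen (sSS' _ Si) (sSS' _ Sj) (sSS' _ Sk) un fE.
exact: arrow_comp S'f S'g.
Qed.

(** Up to sign, the differences are I, M, M - I = M^2, and I - 2M, which equals I because 2 = 0. *)
Lemma five_lines_differences M : M ^+ 2 = M - 1 -> 2%:R = 0 :> K ->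
  forall X Y, X \in [:: 0; 1; M; 1 - M] -> Y \in [:: 0; 1; M; 1 - M] -> X != Y ->
  exists i, exists2 c : K, c != 0 & X - Y = c *: M ^+ i.
Proof.
move=> M2 K2 X Y; pose D A := exists i, exists2 c : K, c != 0 & A = c *: M ^+ i.
have DN A : D A -> D (- A).
  by case=> i [c nz_c ->]; exists i, (- c); rewrite ?oppr_eq0 // scaleNr.
have D1 : D 1 by exists 0%N, 1; rewrite ?oner_neq0 // scale1r.
have DM : D M by exists 1%N, 1; rewrite ?oner_neq0 // scale1r.
have DM1 : D (M - 1) by exists 2%N, 1; rewrite ?oner_neq0 // scale1r M2.
have D1M : D (1 - M) by rewrite -opprB; apply: DN.
have D1MM : D (1 - M - M).
  rewrite -addrA -opprD -mulr2n -scaler_nat K2 scale0r subr0; exact: D1.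
rewrite -/(D _) !inE => /or4P[] /eqP-> /or4P[] /eqP->; rewrite ?eqxx // => _;
  rewrite ?subr0 ?sub0r ?subKr ?opprB //; try exact: DN.
- by rewrite -[M - 1]opprB -[M in M - _]opprK -opprD addrC; apply: DN.
by rewrite addrAC subrr sub0r; apply: DN.
Qed.

(** A loop of S' at L_0 has a matrix c M^i, which also represents the i-th iterate of the loop g of
    S with matrix M; the two loops coincide. Both groupoids thus have the same group at L_0, and
    conjugation handles the other vertices. *)
Lemma G_five_lines (S S' : {fset {vspace ambient K}}) M :
  skew_family (mem S) -> G_isog S 'Z_3 -> S =i four_lines M ->
  skew_family (mem S') -> S' =i five_lines M ->
  M \in unitmx -> M ^+ 2 = M - 1 -> 2%:R = 0 :> K -> G_isog S' 'Z_3.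
Proof.
move=> skS isoS SE skS' S'E Mu M2 K2.
have sSS' : {subset S <= S'}.
  by move=> L; rewrite SE S'E mem_rcons inE => ->; rewrite orbT.
have S0 : mxline 0 \in S by rewrite SE inE eqxx.
have Soo : line_infty K \in S by rewrite SE !inE eqxx orbT.
have S1 : mxline 1%:M \in S by rewrite SE !inE eqxx !orbT.
have SM : mxline M \in S by rewrite SE !inE eqxx !orbT.
have nz_M : M != 0 by apply: contraTneq Mu => ->; rewrite unitmxE det0 unitr0.
have Sid := arrow_id S skS _ _ _ S0 Soo S1 uniq_base_lines.
have [g Sg] := mxline_loop S skS M 0 S0 Soo S1 SM S0 nz_M nz_M.
rewrite subr0 => rg.
have M3 : M ^+ 3 = -1.
  by rewrite exprS M2 mulrBr mulr1 -expr2 M2 addrAC subrr add0r.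
have arrowE (f : point (mxline 0) -> point (mxline 0)) : arrow S' f <-> arrow S f.
  split; last exact: arrow_subset.
  move=> S'f.
  have PM i c : c != 0 -> c *: M ^+ i \in unitmx.
    by move=> nz_c; rewrite unitmxZ ?unitfE //; exact: unitrX.
  have [|||||A [i [c nz_c ->]] rf] := arrow_represents
    (fun A => exists i, exists2 c, c != 0 & A = c *: M ^+ i)
    (fun X => X \in [:: 0; 1; M; 1 - M]) S' _ _ _ _ _ _ _ f S'f.
  - by exists 0%N, 1; rewrite ?oner_neq0 // scale1r.
  - move=> A B [i [c nz_c ->]] [j [d nz_d ->]].
    exists (i + j)%N, (c * d); first by rewrite mulf_neq0.
    by rewrite -scalemxAl -scalemxAr scalerA exprD.
  - move=> A [i [c nz_c ->]]; split; first exact: PM.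
    (* Since M^3 = -1, M^i M^(2i) = (-1)^i, which gives the inverse of c M^i. *)
    exists (2 * i)%N, (c^-1 * (-1) ^+ i).
      by rewrite mulf_neq0 ?invr_eq0 ?signr_eq0.
    rewrite -[RHS](mulKmx (PM i c nz_c)) -[LHS]mulmx1; congr (_ *m _).
    rewrite -scalemxAl -scalemxAr scalerA mulrA mulfV // mul1r.
    rewrite -[M ^+ i *m _]exprD -mulSn exprM M3 -scaleN1r exprZn expr1n scalerA.
    by rewrite -exprMn mulrNN mulr1 expr1n scale1r.
  - exact: five_lines_differences.
  - move=> L; rewrite S'E !inE => /or4P[/eqP-> | /eqP-> | /eqP-> | /orP[] /eqP->].
    + by right; exists 0; rewrite ?inE ?eqxx.
    + by left.
    + by right; exists 1; rewrite ?inE ?eqxx ?orbT.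
    + by right; exists M; rewrite ?inE ?eqxx ?orbT.
    by right; exists (1 - M); rewrite ?inE ?eqxx ?orbT.
  have -> : f = iter i g; last exact: arrow_iter.
  apply: represents_inj rf _; first exact: PM.
  by apply: representsZ; apply: represents_iter.
apply: (G_isog_vertex S' 'Z_3 (mxline 0)).
  move=> L S'L neqL.
  (* L_oo serves as centre between L_0 and L, except when L is L_oo itself; then the line of I
     does. *)
  have [Lk S'k un] : exists2 Lk, Lk \in S' & uniq [:: mxline 0; L; Lk].
    have [->|neqLoo] := eqVneq L (line_infty K).
      by exists (mxline 1%:M); rewrite ?sSS' ?uniq_base_lines.
    exists (line_infty K); first exact: sSS'.
    by rewrite /= !inE negb_or eq_sym neqL neqLoo mxline_neq_infty.
  exact: arrow_iso S' skS' _ _ _ (sSS' _ S0) S'L S'k un.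
have [phi [phiM phi_inj phiE]] := isoS _ S0.
by exists phi; split=> // f; rewrite arrowE phiE.
Qed.

(** A further line is skew to L_oo, hence the graph of some N, and its differences with 0, I and M
    are nonzero multiples of I, M or M^2. *)
Lemma extra_lines (S : {fset {vspace ambient K}}) M :
  skew_family (mem S) -> G_isog S 'Z_3 -> {subset four_lines M <= S} ->
  M \in unitmx -> (forall c, M <> c%:M) -> M ^+ 2 = M - 1 ->
  forall L, L \in S -> L \in four_lines M \/ L = mxline (1 - M) /\ 2%:R = 0 :> K.
Proof.
move=> skS isoS sMS Mu nscal M2 L SL.
have S0 : mxline 0 \in S by rewrite sMS // inE eqxx.
have Soo : line_infty K \in S by rewrite sMS // !inE eqxx orbT.
have S1 : mxline 1%:M \in S by rewrite sMS // !inE eqxx !orbT.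
have SM : mxline M \in S by rewrite sMS // !inE eqxx !orbT.
have [[lineS skewS] [_ diffs]] :=
  (skS, C3_differences S M skS isoS S0 Soo S1 SM Mu nscal).
have [|L4] := boolP (L \in four_lines M); [by left | right].
move: L4; rewrite !inE !negb_or => /and4P[neq0 neqoo neq1 neqM].
have [N LE] := skew_infty_mxline L (lineS L SL) (skewS _ _ SL Soo neqoo).
rewrite {}LE !(inj_eq mxline_inj) in SL neq0 neq1 neqM *.
have [|-> K2] := fifth_line M N nscal M2; last by [].
by move=> Y; rewrite !inE => /or3P[] /eqP->; apply: diffs.
Qed.

End Lines.

(** * Assembly of the two characteristic cases *)

Local Open Scope fset_scope.

Theorem mainTheorem6 (K : closedFieldType) (M2 : 'M[K]_2)
    (M2_unit : M2 \in unitmx)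
    (skew4 : pairwise_skew (four_lines M2))
    (group4 : G_isog [fset L in four_lines M2] 'Z_3) :
  (2%N \notin [pchar K] ->
     forall S : {fset {vspace ambient K}},
       pairwise_skew S -> [fset L in four_lines M2] `<=` S -> G_isog S 'Z_3 ->
       S = [fset L in four_lines M2] /\ (#|` S| <= 4)%N)
  /\
  (2%N \in [pchar K] ->
     (forall S : {fset {vspace ambient K}},
        pairwise_skew S -> [fset L in four_lines M2] `<=` S -> G_isog S 'Z_3 ->
        S `<=` [fset L in five_lines M2] /\ (#|` S| <= 5)%N)
     /\ pairwise_skew (five_lines M2)
     /\ G_isog [fset L in five_lines M2] 'Z_3).
Proof.
set S4 := [fset L in four_lines M2].
have S4E : S4 =i four_lines M2 by move=> L; rewrite in_fset.
have [line4 skewL4] := pairwise_skew_family _ skew4.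
have skS4 : skew_family (mem S4).
  by split=> [L|L L'] /=; rewrite !S4E; [exact: line4 | exact: skewL4].
have S40 : mxline 0 \in S4 by rewrite S4E inE eqxx.
have S4oo : line_infty K \in S4 by rewrite S4E !inE eqxx orbT.
have S41 : mxline 1%:M \in S4 by rewrite S4E !inE eqxx !orbT.
have S4M : mxline M2 \in S4 by rewrite S4E !inE eqxx !orbT.
have nscal := C3_nonscalar S4 M2 skS4 group4 S4E.
have [[d M2cube] diffs] :=
  C3_differences S4 M2 skS4 group4 S40 S4oo S41 S4M M2_unit nscal.
(* The difference between the third and fourth lines is a multiple of a power of M2. *)
have M2quad : M2 ^+ 2 = M2 - 1.
  have [||i [c [lti _ M21E]]] := diffs _ _ S4M S41.
  - by apply/eqP => M20; apply: (nscal 0); rewrite M20 raddf0.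
  - by apply/eqP.
  exact: order3_quadratic nscal M2cube lti M21E.
have extra (S : {fset {vspace ambient K}}) :
    pairwise_skew S -> S4 `<=` S -> G_isog S 'Z_3 -> forall L, L \in S ->
    L \in four_lines M2 \/ L = mxline (1 - M2) /\ 2%:R = 0 :> K.
  move=> skS /fsubsetP sS4 isoS; apply: extra_lines => //.
    exact: pairwise_skew_family.
  by move=> L L4; apply: sS4; rewrite S4E.
have card_le (s : seq {vspace ambient K}) : (#|` [fset L in s]| <= size s)%N.
  by rewrite card_fseq size_undup.
split=> [char_n2 S skS sS4 isoS|/andP[_ /eqP K2]].
  have SE : S = S4.
    apply/eqP; rewrite eqEfsubset sS4 andbT; apply/fsubsetP => L.
    rewrite S4E => /(extra S skS sS4 isoS)[//|[_ K2]].
    by rewrite inE /= K2 eqxx in char_n2.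
  by split=> //; rewrite SE; apply: card_le.
have skS5 : pairwise_skew (five_lines M2).
  (* The matrix I - M2 of the new line has differences -M2^2, -M2 and I - 2 M2 = I with 0, I and M2,
     all invertible. *)
  have skew1M : M2 - 1 \in unitmx.
    by rewrite -M2quad; apply: unitrX.
  have {skew4} [line_s skew_s] := andP skew4.
  rewrite /pairwise_skew all_rcons pairwise_rcons is_line_mxline line_s skew_s.
  rewrite /= (skew_linesC (line_infty K)) skew_mxline_infty !skew_mxline.
  rewrite sub0r unitrN -opprB unitrN opprB skew1M subKr M2_unit.
  by rewrite opprB addrA -mulr2n -scaler_nat K2 scale0r sub0r unitrN unitr1.
split.
  move=> S skS sS4 isoS.
  have sub5 : S `<=` [fset L in five_lines M2].
    apply/fsubsetP => L /(extra S skS sS4 isoS).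
    by rewrite in_fset mem_rcons inE => -[->|[-> _]]; rewrite ?eqxx ?orbT.
  by split=> //; apply: leq_trans (fsubset_leq_card sub5) (card_le _).
split=> //.
have S5E : [fset L in five_lines M2] =i five_lines M2 by move=> L; rewrite in_fset.
have [line5 skewL5] := pairwise_skew_family _ skS5.
apply: (G_five_lines S4 _ M2) => //.
by split=> [L|L L'] /=; rewrite !S5E; [exact: line5 | exact: skewL5].
Qed.
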